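(* Let $G$ be a left topological group which is $\omega$-pseudobounded, feebly compact and Baire. Then $G$ is pseudobounded.
   Context: A left topological group is a group $G$ endowed with a topology such that for every $g\in G$ the left shift $G\to G$, $x\mapsto gx$, is continuous. No separation axiom is assumed. For $U\subseteq G$ and $n\ge 1$, $U^n=\{u_1u_2\cdots u_n: u_1,\dots,u_n\in U\}$. $G$ is pseudobounded if for any neighborhood $U$ of the identity there exists a positive integer $n$ with $U^n=G$. $G$ is $\omega$-pseudobounded if for any neighborhood $U$ of the identity, $G=\bigcup_{n\ge 1}U^n$. A topological space is feebly compact if every locally finite family of nonempty open subsets is finite (equivalently, for every nonincreasing sequence $(U_n)_{n\in\omega}$ of nonempty open sets, $\bigcap_{n}\overline{U_n}\neq\varnothing$). A space is Baire if the intersection of any countable family of open dense subsets is dense. *)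

(* Defs.v *)
From HB Require Import structures.
From mathcomp Require Import all_boot.
From mathcomp Require Import all_classical topology.

Set Implicit Arguments.
Unset Strict Implicit.
Unset Printing Implicit Defensive.

Local Open Scope classical_set_scope.
Local Open Scope group_scope.

HB.mixin Record Group_Topological_isLeftTopological G
    of Group G & Topological G := {
  lmulg_continuous : forall g : G, continuous (fun x : G => g * x)
}.

#[short(type="leftTopologicalGroupType")]
HB.structure Definition LeftTopologicalGroup :=
  {G of Group G & Topological G & Group_Topological_isLeftTopological G}.

Definition setpow (G : groupType) (U : set G) (n : nat) : set G :=
  [set x | exists2 u : 'I_n -> G, (forall i, U (u i)) & x = \prod_(i < n) u i].

Definition pseudobounded (G : leftTopologicalGroupType) : Prop :=
  forall U : set G, nbhs (1 : G) U -> exists2 n, (0 < n)%N & setpow U n = setT.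

Definition omega_pseudobounded (G : leftTopologicalGroupType) : Prop :=
  forall U : set G, nbhs (1 : G) U ->
    \bigcup_(n in [set n | (0 < n)%N]) setpow U n = setT.

(* Families of subsets are sets of subsets. For feeble compactness this agrees
   with indexed families: in a locally finite indexed family, a nonempty member
   can only be repeated finitely many times. *)
Definition locally_finite (T : topologicalType) (F : set (set T)) : Prop :=
  forall x : T, exists2 V : set T,
    nbhs x V & finite_set [set A | F A /\ A `&` V !=set0].

Definition feebly_compact (T : topologicalType) : Prop :=
  forall F : set (set T),
    (forall A, F A -> open A /\ A !=set0) -> locally_finite F -> finite_set F.

Definition baire_space (T : topologicalType) : Prop :=
  forall F : set (set T), countable F ->
    (forall A, F A -> open A /\ dense A) -> dense (\bigcap_(A in F) A).

(* Main.v *)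
(** Let [U] be an open neighbourhood of the identity. If no power [U^n] were
    dense, the exteriors of the powers would be a locally finite family of
    nonempty open sets (each point lies in an open power, which meets only
    finitely many of them), contradicting feeble compactness; so some [U^k] is
    dense. The sets [(U^n)^-1] also cover the group, so by the Baire property
    one of them is dense in some nonempty open set [W]. For every [x] the open
    set [xW] meets the dense open set [U^k], hence [x(U^n)^-1] meets [U^k],
    that is, [x] lies in [U^(k+n)]. *)
Require Import Defs.
From mathcomp Require Import all_boot finmap.
From mathcomp Require Import all_classical topology.

Set Implicit Arguments.
Unset Strict Implicit.
Unset Printing Implicit Defensive.

Local Open Scope classical_set_scope.
Local Open Scope group_scope.

Section SetPow.
Variable G : groupType.
Implicit Types (U V : set G) (x y : G) (m n : nat).

Lemma setpowS U V n : U `<=` V -> setpow U n `<=` setpow V n.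
Proof. by move=> UV x [u Uu ->]; exists u => // i; apply: UV. Qed.

Lemma setpow1 U : setpow U 1 = U.
Proof.
apply/seteqP; split => [x [u Uu ->]|x Ux]; first by rewrite big_ord1.
by exists (fun=> x); rewrite ?big_ord1.
Qed.

Lemma setpowD U m n :
  setpow U (m + n) = [set x * y | x in setpow U m & y in setpow U n].
Proof.
apply/seteqP; split => [_ [u Uu ->]|_ [_ [u Uu ->] [_ [v Uv ->] <-]]].
  rewrite big_split_ord /=; exists (\prod_(i < m) u (lshift n i)).
    by exists (fun i => u (lshift n i)).
  exists (\prod_(i < n) u (rshift m i)) => //.
  by exists (fun i => u (rshift m i)).
exists (fun i => match fintype.split i with inl j => u j | inr j => v j end).
  by move=> i; case: (fintype.split i).
rewrite big_split_ord /=; congr (_ * _); apply: eq_bigr => i _.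
  by rewrite (unsplitK (inl i)).
by rewrite (unsplitK (inr i)).
Qed.

Lemma setpow_le U m n : U 1 -> (m <= n)%N -> setpow U m `<=` setpow U n.
Proof.
move=> U1 /subnKC <- x Umx; rewrite setpowD; exists x => //.
by exists 1; [exists (fun=> 1); rewrite ?big1|rewrite mulg1].
Qed.

End SetPow.

Section LeftTopologicalGroup.
Variable G : leftTopologicalGroupType.
Implicit Types U W : set G.

Lemma open_lmulg_preimage (g : G) U : open U -> open [set x | U (g * x)].
Proof. by move=> oU; apply: open_comp => // x _; apply: lmulg_continuous. Qed.

(** Only left shifts are assumed continuous, but a positive power is a union of left translates of
    [U]. The power of exponent 0 is [{1}], which may fail to be open. *)
Lemma open_setpow U n : open U -> (0 < n)%N -> open (setpow U n).
Proof.
case: n => // n oU _.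
have -> : setpow U n.+1 = \bigcup_(g in setpow U n) [set x | U (g^-1 * x)].
  rewrite -addn1 setpowD setpow1.
  apply/seteqP; split => [_ [g Ug [u Uu <-]]|x [g Ug Ux]].
    by exists g => //=; rewrite mulKg.
  by exists g => //; exists (g^-1 * x); rewrite // mulVKg.
by apply: bigcup_open => g _; apply: open_lmulg_preimage.
Qed.

Lemma omega_pseudobounded_cover U x : omega_pseudobounded G ->
  open U -> U 1 -> exists n, setpow U n.+1 x.
Proof.
move=> omega_pbG oU U1.
have : (\bigcup_(n in [set n | (0 < n)%N]) setpow U n) x.
  by rewrite omega_pbG //; exact: open_nbhs_nbhs.
by case=> -[//|n] _ Ux; exists n.
Qed.

Lemma dense_setpow U : omega_pseudobounded G -> feebly_compact G ->
  open U -> U 1 -> exists n, dense (setpow U n.+1).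
Proof.
move=> omega_pbG fcG oU U1; apply: contrapT => ndense.
pose A n := (~` setpow U n.+1)°.
have A_disj m n x : (m <= n)%N -> A n x -> ~ setpow U m.+1 x.
  by move=> mn /interior_subset Anx /(setpow_le U1 (mn : m.+1 <= n.+1)%N).
have A_neq0 n : A n !=set0.
  have /denseNE[W [[x [oW Wx]] W0]] : ~ dense (setpow U n.+1).
    by move=> ?; apply: ndense; exists n.
  exists x; apply: filterS (open_nbhs_nbhs (conj oW Wx)) => y Wy Uy.
  by rewrite -[False]/(set0 y) -W0.
have finA : finite_set (range A).
  apply: fcG => [_ [n _ <-]|x]; first by split; first exact: open_interior.
  have [m Umx] := omega_pseudobounded_cover x omega_pbG oU U1.
  exists (setpow U m.+1).
    by apply: open_nbhs_nbhs; split => //; exact: open_setpow.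
  (* By [A_disj], only the indices [n < m] can give a set meeting this power. *)
  apply: sub_finite_set (finite_image A (finite_II m)) => _ [[n _ <-] [y [Any]]].
  move=> Umy; exists n => //=; rewrite ltnNge; apply/negP => mn.
  exact: A_disj mn Any Umy.
(* [finA] bounds the number of distinct sets, not their indices. So each member [B] gets an exponent
   [m B], and [N] is the maximum over the members. As [A N] is itself a member, it meets a power of
   exponent at most [N.+1], against [A_disj]. *)
have /choice[m mP] B : exists m, range A B -> B `&` setpow U m.+1 !=set0.
  have [[n _ <-]|] := pselect (range A B); last by exists 0%N.
  have [x Anx] := A_neq0 n.
  by have [m Umx] := omega_pseudobounded_cover x omega_pbG oU U1; exists m, x.
pose N := (\max_(B <- fset_set (range A)) m B)%N.
have [x [ANx]] := mP (A N) (imageT A N).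
apply: A_disj ANx; apply: leq_bigmax_seq => //.
by rewrite in_fset_set // inE; exact: imageT.
Qed.

End LeftTopologicalGroup.

(** Otherwise the complements of the closures are open and dense, and a point of their intersection
    escapes the cover. The point [x] makes the whole space a nonempty open set, so density yields
    such a point. *)
Lemma baire_cover_somewhere_dense (T : topologicalType) (x : T)
    (S : nat -> set T) : baire_space T -> \bigcup_n S n = setT ->
  exists n, exists W : set T, [/\ open W, W !=set0 & W `<=` closure (S n)].
Proof.
move=> baireT coverS; apply: contrapT => nowhere_dense.
have dense_ext n : dense (~` closure (S n)).
  move=> W W0 oW; apply: contrapT => WS; apply: nowhere_dense; exists n, W.
  by split=> // y Wy; apply: contrapT => Sy; apply: WS; exists y.
have /(_ setT)[||y [_ extSy]] :
  dense (\bigcap_(A in range (fun n => ~` closure (S n))) A).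
- apply: baireT; first exact: card_image_le.
  by move=> _ [n _ <-]; split=> //; apply/closed_openC/closed_closure.
- by exists x.
- exact: openT.
have [n _ Sny] : (\bigcup_n S n) y by rewrite coverS.
by apply: (extSy _ (imageT _ n)); exact: subset_closure.
Qed.

Theorem proposition4 (G : leftTopologicalGroupType)
    (omega_pbG : omega_pseudobounded G)
    (feebly_compactG : feebly_compact G)
    (baireG : baire_space G) :
  pseudobounded G.
Proof.
move=> V /nbhs_interior V1.
pose U := V°; have U1 : U 1 by exact: nbhs_singleton.
have oU : open U by exact: open_interior.
have [k denseUk] := dense_setpow omega_pbG feebly_compactG oU U1.
have [|n [W [oW [w Ww] WU]]] :=
    baire_cover_somewhere_dense (1 : G)
      (S := fun n => [set x | setpow U n.+1 x^-1]) baireG.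
  apply/seteqP; split => // x _.
  by have [n] := omega_pseudobounded_cover x^-1 omega_pbG oU U1; exists n.
exists (k.+1 + n.+1)%N => //; apply/seteqP; split => // x _.
apply: (setpowS (@interior_subset _ V)); rewrite setpowD.
have [||y [/= Wy Uy]] := denseUk [set y | W (x^-1 * y)].
- by exists (x * w); rewrite /= mulKg.
- exact: open_lmulg_preimage.
have oxU : open [set z | setpow U k.+1 (x * z)].
  by apply: open_lmulg_preimage; exact: open_setpow.
(* The translate of the open power by [x^-1] is a neighbourhood of [x^-1 * y], a point of the
   closure. The resulting [z] gives [x = (x * z) * z^-1]. *)
have [|z [/= Uz Ukz]] := WU _ Wy [set z | setpow U k.+1 (x * z)].
  by apply: open_nbhs_nbhs; split => //=; rewrite mulVKg.
by exists (x * z) => //; exists z^-1; rewrite // mulgK.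
Qed.
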